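(* Let $d_1,d_2\in\mathbb N$ (positive integers), let $x_1,\ldots,x_{d_1}\in\mathbb R$ be distinct real numbers, and let $D:=d_1+2d_2-1$. Assume that $\gamma=(\gamma_0,\ldots,\gamma_D)\in\mathbb R^{D+1}$ is a sequence such that the moment matrix $M_{\lfloor D/2\rfloor}=(\gamma_{i+j-2})_{i,j=1}^{\lfloor D/2\rfloor+1}$ is positive definite. Denote $e_i:=e_i(x_1,\ldots,x_{d_1})$ and $f(x):=\prod_{i=1}^{d_1}(x-x_i)$. The following statements are equivalent: (1) There exists a $(d_1+d_2)$-atomic $(\mathbb R\cup\{\infty\})$-representing measure $\mu$ for $\gamma$ with $d_1$ atoms equal to $x_1,\ldots,x_{d_1}$. (2) One of the following statements holds: (a) There exists a $(d_1+d_2)$-atomic $\mathbb R$-representing measure $\mu$ for $\gamma$ with $d_1$ atoms equal to $x_1,\ldots,x_{d_1}$, obtained as follows: the localizing matrix $\mathcal H_f(d_2-1)$ is invertible and, with $$(\lambda_0,\ldots,\lambda_{d_2-1})^T=\big(\mathcal H_f(d_2-1)\big)^{-1}\Big(\sum_{i=0}^{d_1}(-1)^ie_i\mathbf v^{(d_2-1)}_{d_1+d_2-i}\Big),\qquad g(x):=x^{d_2}-\sum_{i=0}^{d_2-1}\lambda_ix^i,$$ $$f(x)g(x)=x^{d_1+d_2}-\sum_{i=0}^{d_1+d_2-1}\varphi_ix^i,$$ and with the extension $\{\widetilde\gamma_u\}_{u=0}^{D+d_1-1}$ of $\gamma$ defined by $\widetilde\gamma_u=\gamma_u$ for $0\le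 u\le D$ and $\widetilde\gamma_{D+\ell}=\sum_{i=1}^{d_1+d_2}\varphi_{d_1+d_2-i}\widetilde\gamma_{D+\ell-i}$ for $\ell=1,\ldots,d_1-1$, the moment matrix $M_{d_1+d_2-1}=(\widetilde\gamma_{i+j-2})_{i,j=1}^{d_1+d_2}$ of the extension is positive definite; the atoms of $\mu$ other than $x_1,\ldots,x_{d_1}$ are the zeros of $g$. (b) There exists a $(d_1+d_2-1)$-atomic $\mathbb R$-representing measure $\mu$ for the sequence $\widehat\gamma=(\gamma_0,\ldots,\gamma_{D-2})\in\mathbb R^{D-1}$ with $d_1$ atoms equal to $x_1,\ldots,x_{d_1}$, which also represents $\gamma_{D-1}$ and $\gamma_D-\alpha$ for some $\alpha>0$ (that is, $\int x^{D-1}\,d\mu=\gamma_{D-1}$ and $\int x^{D}\,d\mu=\gamma_D-\alpha$). Namely, the following conditions hold: (i) The localizing matrix $\mathcal H_f(d_2-2)$ is invertible. (ii) Denote $$(\lambda_0,\ldots,\lambda_{d_2-2})^T=\big(\mathcal H_f(d_2-2)\big)^{-1}\Big(\sum_{i=0}^{d_1}(-1)^ie_i\mathbf v^{(d_2-2)}_{d_1+d_2-1-i}\Big),$$ let $$h(x):=f(x)\Big(x^{d_2-1}-\sum_{i=0}^{d_2-2}\lambda_ix^i\Big)=x^{d_1+d_2-1}-\sum_{i=0}^{d_1+d_2-2}\varphi_ix^i,$$ and let $\widetilde\gamma:=\{\widetilde\gamma_u\}_{u=0}^{D+d_1-3}$ be defined by $\widetilde\gamma_u=\gamma_u$ for $0\le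 u\le D-2$ and $$\widetilde\gamma_{D-2+\ell}=\sum_{i=1}^{d_1+d_2-1}\varphi_{d_1+d_2-1-i}\,\widetilde\gamma_{D-2+\ell-i}\qquad\text{for }\ell=1,\ldots,d_1-1.$$ The moment matrix $M_{d_1+d_2-2}=(\widetilde\gamma_{i+j-2})_{i,j=1}^{d_1+d_2-1}$ of $\widetilde\gamma$ is positive definite, $\widetilde\gamma_{D-1}=\gamma_{D-1}$ and $\widetilde\gamma_D<\gamma_D$.
   Context: Measures: an $N$-atomic positive measure on $\mathbb R$ is $\mu=\sum_{j=1}^N\rho_j\delta_{y_j}$ with distinct atoms $y_j\in\mathbb R$ and densities $\rho_j>0$, where $\delta_y$ is the Dirac measure at $y$. It is an $\mathbb R$-representing measure for a sequence $(\gamma_0,\ldots,\gamma_n)$ if $\gamma_i=\int_{\mathbb R}x^i\,d\mu$ for all $0\le i\le n$. Evaluation at infinity: $\mathbf{ev}_\infty:\mathbb R[x]_{\le D}\to\mathbb R$, $\sum_{k=0}^Df_kx^k\mapsto f_D$. An $N$-atomic $(\mathbb R\cup\{\infty\})$-representing measure for $\gamma=(\gamma_0,\ldots,\gamma_D)$ is either an $N$-atomic $\mathbb R$-representing measure for $\gamma$, or a formal sum $\sum_{j=1}^{N-1}\rho_j\delta_{y_j}+\rho_N\mathbf{ev}_\infty$ with distinct $y_j\in\mathbb R$ and all $\rho_j>0$ such that $\gamma_i=\sum_{j=1}^{N-1}\rho_jy_j^i+\rho_N\mathbf{ev}_\infty(x^i)$ for all $0\le i\le D$ (so $\infty$ counts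 as one atom and contributes only to $\gamma_D$). Riesz functional: $L:\mathbb R[x]_{\le D}\to\mathbb R$ is the linear functional with $L(x^i)=\gamma_i$. Localizing matrix: for a polynomial $f$ of degree at most $D$, put $\gamma^{(f)}_i:=L(f\,x^i)$ for $0\le i\le D-\deg f$, and $\mathcal H_f(\ell):=\big(\gamma^{(f)}_{i+j-2}\big)_{i,j=1}^{\ell+1}$, an $(\ell+1)\times(\ell+1)$ matrix. Vectors: $\mathbf v_i^{(j)}:=(\gamma_i,\gamma_{i+1},\ldots,\gamma_{i+j})^T\in\mathbb R^{j+1}$. Elementary symmetric polynomials: $e_0=1$ and $e_i(x_1,\ldots,x_{d_1})=\sum_{1\le j_1<\cdots<j_i\le d_1}x_{j_1}\cdots x_{j_i}$.
   Formalization: In (2b)(ii) the recurrence for γ̃ is used for all ℓ ≥ 1, since the listed range ℓ ≤ d_1−1 leaves γ̃_{D−1}, γ̃_D undefined when d_1=1 and γ̃_D when d_1=2; for d_2=1, H_f(−1) is the empty (invertible) matrix and h=f. *)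

(* Defs.v *)
From HB Require Import structures.
From mathcomp Require Import all_boot all_order all_algebra.
From mathcomp Require Import all_classical all_reals all_analysis.

Set Implicit Arguments.
Unset Strict Implicit.
Unset Printing Implicit Defensive.

Import Order.TTheory GRing.Theory Num.Theory.

Local Open Scope classical_set_scope.
Local Open Scope ring_scope.

(* A truncated sequence (g_0, ..., g_n) is a [seq R] of size n.+1, and g_i is
   written g`_i. *)

Definition posdefmx (R : realType) (n : nat) (A : 'M[R]_n) : Prop :=
  A^T = A /\ forall v : 'cV[R]_n, v != 0 -> 0 < (v^T *m A *m v) 0 0.

(* M_n, of size n.+1. *)
Definition moment_mx (R : realType) (g : nat -> R) (n : nat) : 'M[R]_n.+1 :=
  \matrix_(i, j) g (i + j)%N.

Definition Riesz (R : realType) (g : seq R) (p : {poly R}) : R :=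
  \sum_(i < size p) p`_i * g`_i.

(* H_f(l) is [localizing_mx g f l.+1]: the last argument is the size, so that
   H_f(-1) is the empty matrix, which is invertible. *)
Definition localizing_mx (R : realType) (g : seq R) (f : {poly R}) (m : nat) :
    'M[R]_m :=
  \matrix_(i, j) Riesz g (f * 'X^(i + j)).

(* v_i^(j) is [moment_vec g i j.+1]. *)
Definition moment_vec (R : realType) (g : seq R) (i m : nat) : 'cV[R]_m :=
  \col_(k < m) g`_(i + k).

Definition elem_sym (R : realType) (d : nat) (x : 'I_d -> R) (i : nat) : R :=
  \sum_(S : {set 'I_d} | #|S| == i) \prod_(j in S) x j.

Definition root_poly (R : realType) (d : nat) (x : 'I_d -> R) : {poly R} :=
  \prod_(i < d) ('X - (x i)%:P).

(* In the next two definitions m is the number of real atoms other than the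
   prescribed ones: d2 when infinity is not an atom, d2 - 1 when it is. *)
Definition lambda_vec (R : realType) (d : nat) (x : 'I_d -> R) (g : seq R)
    (m : nat) : 'cV[R]_m :=
  invmx (localizing_mx g (root_poly x) m) *m
  \sum_(i < d.+1) ((-1) ^+ i * elem_sym x i) *: moment_vec g (d + m - i) m.

Definition other_atoms_poly (R : realType) (d : nat) (x : 'I_d -> R) (g : seq R)
    (m : nat) : {poly R} :=
  'X^m - \sum_(i < m) lambda_vec x g m i 0 *: 'X^i.

(* The phi_i with p = 'X^N - \sum_(i < N) phi_i *: 'X^i. *)
Definition rec_coef (R : realType) (N : nat) (p : {poly R}) (i : nat) : R :=
  ('X^N - p)`_i.

Definition rec_step (R : realType) (N : nat) (p : {poly R}) (s : seq R) :
    seq R :=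
  rcons s (\sum_(1 <= i < N.+1) rec_coef N p (N - i) * s`_(size s - i)).

(* The terms of s, followed by the terms given by the recurrence; see
   [rec_extension_base] and [rec_extension_rec]. *)
Definition rec_extension (R : realType) (N : nat) (p : {poly R}) (s : seq R)
    (u : nat) : R :=
  (iter u (rec_step N p) s)`_u.

Lemma size_iter_rec_step (R : realType) N (p : {poly R}) (s : seq R) u :
  size (iter u (rec_step N p) s) = (u + size s)%N.
Proof. by elim: u => //= u IH; rewrite size_rcons IH. Qed.

Lemma nth_iter_rec_step (R : realType) N (p : {poly R}) (s : seq R) u v k :
  (k < u + size s)%N ->
  (iter (v + u) (rec_step N p) s)`_k = (iter u (rec_step N p) s)`_k.
Proof.
move=> ku; elim: v => //= v IH.
rewrite nth_rcons size_iter_rec_step (leq_trans ku) //.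
by rewrite leq_add2r leq_addl.
Qed.

Lemma rec_extension_base (R : realType) N (p : {poly R}) (s : seq R) u :
  (u < size s)%N -> rec_extension N p s u = s`_u.
Proof.
move=> us; rewrite /rec_extension.
by have := @nth_iter_rec_step R N p s 0 u u us; rewrite addn0.
Qed.

Lemma rec_extension_rec (R : realType) N (p : {poly R}) (s : seq R) u :
  (0 < N <= size s)%N -> (size s <= u)%N ->
  rec_extension N p s u =
  \sum_(1 <= i < N.+1) rec_coef N p (N - i) * rec_extension N p s (u - i).
Proof.
move=> /andP[N0 Ns] su.
have s0 : (0 < size s)%N by exact: leq_trans Ns.
set w := (u - size s)%N.
have uE : u = (w + size s)%N by rewrite /w subnK.
rewrite {1}/rec_extension (_ : iter u _ _ = iter ((u - w.+1) + w.+1) (rec_step N p) s);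
  last by rewrite subnK // uE -addn1 leq_add2l.
rewrite nth_iter_rec_step; last by rewrite uE addSn.
rewrite /= nth_rcons size_iter_rec_step -uE ltnn eqxx.
apply: eq_big_nat => i /andP[i1 iN]; congr (_ * _).
rewrite /rec_extension.
have uiw : (u - i < w + size s)%N.
  by rewrite -uE ltn_subrL i1 (leq_trans s0 su).
have [le|/ltnW le] := leqP w (u - i).
  by rewrite -(nth_iter_rec_step N p (u - i - w) uiw) subnK.
have uii : (u - i < u - i + size s)%N by rewrite -ltn_subLR // subnn.
by rewrite -(nth_iter_rec_step N p (w - (u - i)) uii) subnK.
Qed.

(* mu = \sum_j rho_j \d_(y_j) with distinct y_j and rho_j > 0, where s is the
   list of the y_j; mu is N-atomic when moreover [size s = N]. *)
Definition atomic_measure (R : realType)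
    (mu : {measure set (measurableTypeR R) -> \bar R}) (s : seq R) : Prop :=
  uniq s /\
  exists rho : R -> R, (forall y, y \in s -> 0 < rho y) /\
    forall A : set (measurableTypeR R), measurable A ->
      mu A = (\sum_(y <- s) (rho y)%:E * \d_(y : measurableTypeR R) A)%E.

Definition moment (R : realType)
    (mu : {measure set (measurableTypeR R) -> \bar R}) (i : nat) : \bar R :=
  (\int[mu]_x ((x : R) ^+ i)%:E)%E.

Definition R_representing (R : realType) (g : seq R)
    (mu : {measure set (measurableTypeR R) -> \bar R}) : Prop :=
  forall i : nat, (i < size g)%N -> (g`_i)%:E = moment mu i.

Definition R_representing_atomic (R : realType) (g : seq R) (N : nat)
    (mu : {measure set (measurableTypeR R) -> \bar R}) (s : seq R) : Prop :=
  [/\ atomic_measure mu s, size s = N & R_representing g mu].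

Definition ev_infty (R : realType) (D : nat) (p : {poly R}) : R := p`_D.

(* An N-atomic (R + infinity)-representing measure for (g_0, ..., g_D), with s
   the list of its real atoms. *)
Definition Rinf_representing_atomic (R : realType) (g : seq R) (N : nat)
    (s : seq R) : Prop :=
  (exists mu : {measure set (measurableTypeR R) -> \bar R},
     R_representing_atomic g N mu s) \/
  (exists (mu : {measure set (measurableTypeR R) -> \bar R}) (rhoN : R),
     [/\ atomic_measure mu s, (size s).+1 = N, 0 < rhoN &
       forall i : nat, (i < size g)%N ->
         (g`_i)%:E =
         (moment mu i + (rhoN * ev_infty (size g).-1 'X^i)%:E)%E]).

(* Main.v *)
Require Import Defs.
From HB Require Import structures.
From mathcomp Require Import all_boot all_order all_algebra.
From mathcomp Require Import all_classical all_reals all_analysis.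
From mathcomp Require Import measurable_realfun polydiv separable complex ring zify.

Set Implicit Arguments.
Unset Strict Implicit.
Unset Printing Implicit Defensive.

Import Order.TTheory GRing.Theory Num.Theory.

Local Open Scope classical_set_scope.
Local Open Scope ring_scope.

(* With m = d2 for (a) and m = d2 - 1 for (b), both parts are the same
   statement about the first d1 + 2m moments and measures with d1 + m atoms.

   If mu is such a measure, with atoms x_i and y_j, then f * \prod_j (X - y_j)
   vanishes on the support, so the coefficients of \prod_j (X - y_j) solve the
   linear system defining the lambda_i. Its matrix H_f is invertible, as it is
   the Gram matrix of the quadrature with m nodes y_j and nonzero weights
   rho_j f(y_j). Hence g = \prod_j (X - y_j) and the recurrence reproduces the
   moments of mu.

   Conversely, the extended functional L kills all multiples of p = f * g and
   satisfies L(q^2) > 0 for 0 != q of degree < deg p. A factorization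
   p = ((X - a)^2 + b^2) q would give
   0 = L(p q) = L(((X - a) q)^2) + b^2 L(q^2) > 0; so the roots of p are real
   and simple, and L is the quadrature on these roots with weights L(l_y^2),
   l_y being the Lagrange interpolation polynomials. *)

(** * Linear functionals on polynomials given by infinite sequences *)

Section PolyFunctional.
Variable R : realType.
Implicit Types (E : nat -> R) (p q : {poly R}).

(** A total sequence makes the functional linear on all of [{poly R}] and covers both [nth 0 s],
    where it is convertible to [Riesz s], and recursive extensions. *)
Definition Riesz_fun E p : R := \sum_(i < size p) p`_i * E i.

Lemma Riesz_fun_wide E n p : (size p <= n)%N ->
  Riesz_fun E p = \sum_(i < n) p`_i * E i.
Proof.
move=> pn; rewrite /Riesz_fun -!(big_mkord xpredT (fun i => p`_i * E i)).
rewrite [RHS](big_cat_nat (n := size p))//=.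
rewrite [X in _ + X]big_nat_cond [X in _ + X]big1 ?addr0//.
by move=> i /andP[/andP[pi _] _]; rewrite nth_default ?mul0r.
Qed.

Lemma Riesz_fun_linear E : linear_for *%R (Riesz_fun E).
Proof.
move=> a p q; pose n := maxn (size p) (size q).
rewrite (@Riesz_fun_wide E n (a *: p + q)) ?(@Riesz_fun_wide E n p)
  ?(@Riesz_fun_wide E n q) ?leq_maxl ?leq_maxr//; last first.
  by rewrite (leq_trans (size_polyD _ _))// geq_max leq_maxr
    (leq_trans (size_scale_leq _ _)) ?leq_maxl.
rewrite mulr_sumr -big_split; apply: eq_bigr => i _ /=.
by rewrite coefD coefZ mulrDl mulrA.
Qed.

HB.instance Definition _ E := GRing.isLinear.Build R {poly R} R _ (Riesz_fun E)
  (Riesz_fun_linear E).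

Lemma Riesz_funXn E n : Riesz_fun E 'X^n = E n.
Proof.
rewrite (@Riesz_fun_wide _ n.+1) ?size_polyXn// (bigD1 ord_max)//= coefXn eqxx mul1r.
rewrite big1 ?addr0// => i /eqP ni; rewrite coefXn.
by case: eqP => [iE|_]; [case: ni; apply: val_inj | rewrite mul0r].
Qed.

Lemma Riesz_fun_mulXn E p k :
  Riesz_fun E (p * 'X^k) = Riesz_fun (fun i => E (i + k)%N) p.
Proof.
rewrite -{1}[p]coefK poly_def mulr_suml linear_sum; apply: eq_bigr => i _.
by rewrite -scalerAl -exprD linearZ /= Riesz_funXn.
Qed.

Lemma eq_Riesz_fun E1 E2 n p : (size p <= n)%N ->
  (forall i, (i < n)%N -> E1 i = E2 i) -> Riesz_fun E1 p = Riesz_fun E2 p.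
Proof.
move=> pn E12; apply: eq_bigr => i _; congr (_ * _); apply: E12.
exact: leq_trans pn.
Qed.

Lemma Riesz_fun_annihilates E p :
  (forall k, Riesz_fun E (p * 'X^k) = 0) -> forall q, Riesz_fun E (p * q) = 0.
Proof.
move=> pX q; rewrite -[q]coefK poly_def mulr_sumr linear_sum big1// => i _.
by rewrite -scalerAr linearZ /= pX mulr0.
Qed.

(** Vanishing on all [p * 'X^k] is thus a linear recurrence that expresses each [E (N + k)] by the
    [N] terms before it. *)
Lemma Riesz_fun_monicXn E p N k : p \is monic -> size p = N.+1 ->
  Riesz_fun E (p * 'X^k) = E (N + k)%N + \sum_(i < N) p`_i * E (i + k)%N.
Proof.
move=> /monicP pm pN; rewrite Riesz_fun_mulXn /Riesz_fun pN big_ord_recr/= addrC.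
by move: pm; rewrite lead_coefE pN /= => ->; rewrite mul1r.
Qed.

(** Strong induction: from index [N] on, both sequences obey the recurrence with characteristic
    polynomial [p]. *)
Lemma Riesz_fun_annihilated_eq E1 E2 p N : p \is monic -> size p = N.+1 ->
  (forall q, Riesz_fun E1 (p * q) = 0) -> (forall q, Riesz_fun E2 (p * q) = 0) ->
  (forall i, (i < N)%N -> E1 i = E2 i) -> E1 =1 E2.
Proof.
move=> pm pN E1p E2p E12 u; have [n] := ubnP u; elim: n u => // n IH u un.
have [/E12//|Nu] := ltnP u N.
move: (E1p 'X^(u - N)) (E2p 'X^(u - N)).
rewrite !(Riesz_fun_monicXn _ _ pm pN) subnKC// => /eqP + /eqP.
rewrite !addr_eq0 => /eqP-> /eqP->; congr (- _); apply: eq_bigr => i _.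
congr (_ * _); apply: IH.
rewrite ltnS in un; apply: leq_trans un.
by rewrite -[in ltnRHS](subnKC Nu) ltn_add2r.
Qed.

Definition atomic_moments (t : seq R) (rho : R -> R) (i : nat) : R :=
  \sum_(y <- t) rho y * y ^+ i.

Lemma Riesz_fun_atomic t rho p :
  Riesz_fun (atomic_moments t rho) p = \sum_(y <- t) rho y * p.[y].
Proof.
rewrite /Riesz_fun; under eq_bigr do rewrite mulr_sumr.
rewrite exchange_big; apply: eq_bigr => y _ /=.
by rewrite horner_coef mulr_sumr; apply: eq_bigr => i _; rewrite mulrCA.
Qed.

End PolyFunctional.

(** * The recursive extension as a functional killing an ideal *)

Section Recurrence.
Variable R : realType.
Implicit Types (p q : {poly R}) (s : seq R).

(** Only the products [p * 'X^k] that fit in the given data need an assumption; for larger [k] the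
    vanishing is the defining recurrence. *)
Lemma rec_extension_annihilated N p s : (0 < N <= size s)%N -> p \is monic ->
  size p = N.+1 ->
  (forall k, (N + k < size s)%N -> Riesz_fun (nth 0 s) (p * 'X^k) = 0) ->
  forall q, Riesz_fun (rec_extension N p s) (p * q) = 0.
Proof.
move=> Ns pm pN sp; apply: Riesz_fun_annihilates => k.
have [lt|ge] := ltnP (N + k) (size s).
  rewrite -[RHS](sp k lt); apply: (@eq_Riesz_fun _ _ _ (N + k).+1).
    by rewrite size_Mmonic ?monicXn ?monic_neq0// pN size_polyXn /= addnS.
  by move=> i ik; rewrite rec_extension_base// (leq_trans ik).
rewrite (Riesz_fun_monicXn _ _ pm pN) rec_extension_rec//.
rewrite big_add1 /= big_mkord.
(* Once the second sum is reversed, the two sums cancel termwise: below degree [N], [rec_coef] is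
   the opposite of the coefficient of [p]. *)
rewrite [X in _ + X](reindex_inj rev_ord_inj) /= -big_split big1// => i _ /=.
have -> : (N - i.+1 + k = N + k - i.+1)%N by rewrite addnBAC.
rewrite -mulrDl /rec_coef coefB coefXn.
rewrite (_ : (N - i.+1 == N)%N = false) ?sub0r ?addNr ?mul0r//.
by apply/negbTE; rewrite neq_ltn ltn_subrL /= (leq_ltn_trans _ (ltn_ord i)).
Qed.

End Recurrence.

(** * Moment matrices as quadratic forms on polynomials *)

Section QuadraticForm.
Variable R : realType.
Implicit Types (E : nat -> R) (p q : {poly R}).

Lemma rVpoly_sum n (v : 'rV[R]_n) : rVpoly v = \sum_(i < n) v 0 i *: 'X^i.
Proof.
rewrite /rVpoly poly_def; apply: eq_bigr => i _; rewrite insubT//= => Hi.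
by congr (v _ _ *: _); apply: val_inj.
Qed.

Lemma Riesz_fun_rVpoly E n (v : 'rV[R]_n) :
  Riesz_fun E (rVpoly v) = \sum_(i < n) v 0 i * E i.
Proof.
rewrite rVpoly_sum linear_sum; apply: eq_bigr => i _.
by rewrite linearZ /= Riesz_funXn.
Qed.

Lemma moment_mx_form E n (v : 'cV[R]_n.+1) :
  (v^T *m moment_mx E n *m v) 0 0 = Riesz_fun E (rVpoly v^T * rVpoly v^T).
Proof.
rewrite {2}rVpoly_sum mulr_sumr linear_sum -mulmxA mxE /=.
apply: eq_bigr => i _; rewrite -scalerAr linearZ /= Riesz_fun_mulXn; congr (_ * _).
rewrite Riesz_fun_rVpoly mxE; apply: eq_bigr => j _.
by rewrite !mxE mulrC addnC.
Qed.

(** Reading vectors as coefficient lists turns the quadratic form of the matrix into [p] mapped to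
    L(p^2). *)
Lemma posdef_moment_mxP E n : posdefmx (moment_mx E n) <->
  forall p, p != 0 -> (size p <= n.+1)%N -> 0 < Riesz_fun E (p * p).
Proof.
split=> [[_ pos] p p0 pn|pos].
  have := pos (poly_rV p : 'rV_n.+1)^T; rewrite moment_mx_form trmxK poly_rV_K//.
  apply; apply: contraNneq p0 => v0.
  by rewrite -(poly_rV_K pn) -[poly_rV p]trmxK v0 trmx0 linear0.
split; first by apply/matrixP => i j; rewrite !mxE addnC.
move=> v v0; rewrite moment_mx_form; apply: pos; last exact: size_poly.
by apply: contraNneq v0 => v0; rewrite -[v]trmxK -[v^T]rVpolyK v0 linear0 trmx0.
Qed.

End QuadraticForm.

(** * Monic real polynomials: simple real roots or a quadratic factor *)

Section RealRoots.

Lemma size_quadratic (R : idomainType) (a b : R) :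
  size (('X - a%:P) ^+ 2 + b%:P) = 3.
Proof.
have -> : ('X - a%:P) ^+ 2 + b%:P = ('X - (2 * a)%:P) * 'X + (a ^+ 2 + b)%:P.
  by rewrite !polyCD !polyCM; ring.
by rewrite -cons_poly_def size_cons_poly nil_poly polyXsubC_eq0 size_XsubC.
Qed.

(** A complex root a + ib yields the factor X - a if b = 0, and (X - a)^2 + b^2 otherwise. The
    second alternative allows b = 0, so it also absorbs multiple real roots. *)
Lemma monic_split_or_quadratic (R : rcfType) (p : {poly R}) : p \is monic ->
  (exists2 t : seq R, uniq t & p = \prod_(y <- t) ('X - y%:P)) \/
  (exists a b q, p = (('X - a%:P) ^+ 2 + (b ^+ 2)%:P) * q).
Proof.
have [n] := ubnP (size p); elim: n p => // n IH p pn pm.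
have [/eqP/size_poly1P[c _ pc]|p1] := eqVneq (size p) 1%N.
  left; exists [::] => //; rewrite big_nil pc.
  by move: pm; rewrite pc monicE lead_coefC => /eqP ->.
have /closed_rootP[[a b] rab] : size (map_poly (real_complex R) p) != 1%N.
  by rewrite size_map_poly.
have [b0|b0] := eqVneq b 0.
  have : root p a.
    by move: rab; rewrite b0 -[Complex a 0]/(real_complex R a) fmorph_root.
  move=> /factor_theorem[q pE]; have qm : q \is monic.
    by move: pm; rewrite pE monicMr ?monicXsubC.
  have [|//|[t ut qE]|[a' [b' [r qE]]]] := IH q.
  - rewrite -ltnS (leq_trans _ pn)// pE size_Mmonic ?monicXsubC ?monic_neq0//.
    by rewrite size_XsubC addn2.
  (* A repeated real root gives the factor (X - a)^2, the second alternative with b = 0. *)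
  - have [ta|ta] := boolP (a \in t).
      have : root q a by rewrite qE root_prod_XsubC.
      move=> /factor_theorem[r rE]; right; exists a, 0, r.
      by rewrite pE rE expr0n polyC0 addr0 -mulrA mulrC -expr2.
    by left; exists (a :: t); rewrite /= ?ta// big_cons pE qE mulrC.
  - by right; exists a', b', (r * ('X - a%:P)); rewrite pE qE mulrA.
right; pose d : {poly R} := ('X - a%:P) ^+ 2 + (b ^+ 2)%:P.
exists a, b, (divp p d).
have sd : size d = 3 by exact: size_quadratic.
have d0 : d != 0 by rewrite -size_poly_gt0 sd.
(* The remainder is real of degree at most 1 and vanishes at the non-real number a + ib, so both its
   coefficients are 0. *)
suff : modp p d = 0 by move=> r0; rewrite {1}(divp_eq p d) r0 addr0 mulrC.
have sr : (size (modp p d) <= 2)%N by have := ltn_modp p d; rewrite d0 sd.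
have rE : modp p d = (modp p d)`_1 *: 'X + ((modp p d)`_0)%:P.
  apply/polyP => -[|[|i]]; rewrite coefD coefZ coefX coefC /= ?mulr0 ?mulr1
    ?add0r ?addr0//; exact: nth_default (leq_trans sr _).
have : root (map_poly (real_complex R) (modp p d)) (Complex a b).
  move: rab; rewrite {1}(divp_eq p d) rmorphD rmorphM /= rootE hornerD hornerM.
  have -> : (map_poly (real_complex R) d).[Complex a b] = 0.
    rewrite /d rmorphD rmorphXn rmorphB /= map_polyX !map_polyC /=.
    rewrite !hornerE.
    rewrite expr2 -[0]/(0 +i* 0)%C; congr (_ +i* _)%C => /=; ring.
  by rewrite mulr0 add0r.
rewrite rE rmorphD /= map_polyZ map_polyX map_polyC /= rootE hornerD hornerZ.
rewrite hornerX hornerC => /eqP[].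
rewrite !mul0r subr0 !addr0 => /[swap]/eqP.
rewrite mulf_eq0 (negPf b0) orbF => /eqP ->; rewrite mul0r add0r => ->.
by rewrite scale0r addr0.
Qed.

End RealRoots.

(** * Gauss quadrature from positivity *)

Section Quadrature.
Variable R : realType.
Implicit Types (E : nat -> R) (p q : {poly R}) (t : seq R).

Lemma posdef_prod_XsubC E p N : p \is monic -> size p = N.+1 ->
  (forall q, Riesz_fun E (p * q) = 0) ->
  (forall q, q != 0 -> (size q <= N)%N -> 0 < Riesz_fun E (q * q)) ->
  exists2 t, uniq t & p = \prod_(y <- t) ('X - y%:P).
Proof.
move=> pm pN Ep pos; have [//|[a [b [q pE]]]] := monic_split_or_quadratic pm.
have p0 := monic_neq0 pm.
have q0 : q != 0 by apply: contraNneq p0 => q0; rewrite pE q0 mulr0.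
have sq : (size q).+2 = N.+1.
  rewrite -pN pE size_mul ?size_quadratic//.
  by rewrite -size_poly_gt0 size_quadratic.
have := Ep q; rewrite pE.
have -> : (('X - a%:P) ^+ 2 + (b ^+ 2)%:P) * q * q =
    (('X - a%:P) * q) * (('X - a%:P) * q) + b ^+ 2 *: (q * q).
  by rewrite -mul_polyC; ring.
rewrite linearD linearZ /= => /eqP; rewrite gt_eqF//.
(* As [b] may be 0, strictness must come from the first square; [('X - a%:P) * q] has size exactly
   [N], within the range of positivity. *)
apply: ltr_wpDr.
  by rewrite mulr_ge0 ?sqr_ge0// ltW// pos// -ltnS -sq ltnW.
apply: pos; first by rewrite mulf_neq0 ?polyXsubC_eq0.
by rewrite mulrC size_Mmonic ?monicXsubC// size_XsubC addn2 /= -ltnS sq.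
Qed.

(** On the nodes the Lagrange polynomial [w y] equals its square, so L(w_y^2) can serve as weight,
    which is visibly positive. *)
Lemma Gauss_quadrature E p N : p \is monic -> size p = N.+1 ->
  (forall q, Riesz_fun E (p * q) = 0) ->
  (forall q, q != 0 -> (size q <= N)%N -> 0 < Riesz_fun E (q * q)) ->
  exists t rho, [/\ uniq t, p = \prod_(y <- t) ('X - y%:P),
    forall y, y \in t -> 0 < rho y & E =1 atomic_moments t rho].
Proof.
move=> pm pN Ep pos; have [t ut pE] := posdef_prod_XsubC pm pN Ep pos.
have st : size t = N by move: pN; rewrite pE size_prod_XsubC => -[].
pose l y : {poly R} := \prod_(z <- rem y t) ('X - z%:P).
have l_y y : y \in t -> (l y).[y] != 0.
  by move=> yt; rewrite -rootE root_prod_XsubC mem_rem_uniqF.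
have l_z y z : y \in t -> z \in t -> z != y -> (l y).[z] = 0.
  move=> yt zt zy; apply/eqP; rewrite -rootE root_prod_XsubC mem_rem_uniq// !inE.
  by rewrite zy.
pose w y : {poly R} := (l y).[y]^-1 *: l y.
have w_y y : y \in t -> (w y).[y] = 1 by move=> yt; rewrite hornerZ mulVf ?l_y.
have w_z y z : y \in t -> z \in t -> z != y -> (w y).[z] = 0.
  by move=> yt zt zy; rewrite hornerZ (l_z _ _ yt zt zy) mulr0.
exists t, (fun y => Riesz_fun E (w y * w y)); split=> // [y yt|u].
  apply: pos.
    by rewrite scaler_eq0 invr_eq0 negb_or l_y// monic_neq0// monic_prod_XsubC.
  rewrite (leq_trans (size_scale_leq _ _))// size_prod_XsubC size_rem// st prednK//.
  by rewrite -st lt0n size_eq0; apply: contraTneq yt => ->.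
(* [r] vanishes at every node, so it is a multiple of [p] and is killed by the functional, whatever
   the degree [u]. *)
pose r := 'X^u - \sum_(y <- t) y ^+ u *: (w y * w y).
have /uniq_roots_prod_XsubC[|q rE] : all (root r) t.
- apply/allP => z zt; rewrite rootE /r !hornerE horner_sum (bigD1_seq z)//=.
  rewrite hornerZ hornerM !w_y// !mulr1 big1_seq ?addr0 ?subrr// => y /andP[yz yt].
  by rewrite hornerZ hornerM (w_z y z) ?mulr0 1?eq_sym.
- by rewrite uniq_rootsE.
have : Riesz_fun E r = 0 by rewrite rE mulrC -pE Ep.
move=> /eqP; rewrite /r linearB /= subr_eq0 Riesz_funXn => /eqP ->.
rewrite linear_sum; apply: eq_bigr => y _.
by rewrite linearZ /= mulrC.
Qed.

End Quadrature.

(** * The linear system defining [other_atoms_poly], as orthogonality relations *)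

Section PrescribedAtoms.
Variables (R : realType) (d : nat) (x : 'I_d -> R).
Implicit Types (p q : {poly R}) (s : seq R).
Local Notation f := (root_poly x).

Lemma root_polyE : f = \prod_(y <- codom x) ('X - y%:P).
Proof. by rewrite codomE big_map big_enum. Qed.

Lemma root_poly_monic : f \is monic.
Proof. exact: monic_prod_XsubC. Qed.

Lemma size_root_poly : size f = d.+1.
Proof. by rewrite root_polyE size_prod_XsubC size_codom card_ord. Qed.

Lemma root_root_poly y : root f y = (y \in codom x).
Proof. by rewrite root_polyE root_prod_XsubC. Qed.

(** Vieta's formula: in the expanded product, [S] is the set of factors that contribute their
    constant term. *)
Lemma coef_root_poly i : (i <= d)%N -> f`_(d - i) = (-1) ^+ i * elem_sym x i.
Proof.
move=> id; rewrite /root_poly; under eq_bigr do rewrite addrC -polyCN.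
rewrite bigA_distr coef_sum /elem_sym mulr_sumr [RHS]big_mkcond /=.
apply: eq_bigr => S _; rewrite big_if /= -rmorph_prod prodr_const.
rewrite coefCM coefXn.
have dE : (#|S| + #|[predC S]| = d)%N by rewrite cardC card_ord.
have Sd : (#|S| <= d)%N by move: (leq_addr #|[predC S]| #|S|); rewrite dE.
rewrite (_ : #|_| = d - #|S|)%N; last first.
  by move: (addKn #|S| #|[predC S]|); rewrite dE => ->.
rewrite (eqn_sub2lE id Sd) [i == _]eq_sym; case: eqP => [|_]; last by rewrite mulr0.
move=> iS; have -> : i = #|S| by rewrite -(subKn id) iS subKn.
by rewrite mulr1 prodrN.
Qed.

(** The localizing matrix is the Gram matrix of the form (q, r) -> L(f q r) on polynomials of degree
    below [m]. *)
Lemma mul_localizing_mx s m (v : 'rV[R]_m) j :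
  (v *m localizing_mx s f m) 0 j = Riesz_fun (nth 0 s) (f * rVpoly v * 'X^j).
Proof.
rewrite mxE rVpoly_sum mulr_sumr mulr_suml linear_sum; apply: eq_bigr => i _.
by rewrite mxE -scalerAr -scalerAl linearZ /= exprD mulrA.
Qed.

Lemma tr_localizing_mx s m : (localizing_mx s f m)^T = localizing_mx s f m.
Proof. by apply/matrixP => i j; rewrite !mxE addnC. Qed.

(** By Vieta, the alternating sum of moment vectors collects the coefficients of [f]. *)
Lemma localizing_rhsE s m k :
  (\sum_(i < d.+1) ((-1) ^+ i * elem_sym x i) *: moment_vec s (d + m - i) m) k 0
  = Riesz_fun (nth 0 s) (f * 'X^(m + k)).
Proof.
rewrite Riesz_fun_mulXn (@Riesz_fun_wide _ _ d.+1) ?size_root_poly// summxE.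
rewrite [RHS](reindex_inj rev_ord_inj); apply: eq_bigr => i _ /=.
have id : (i <= d)%N by rewrite -ltnS.
rewrite !mxE subSS coef_root_poly//; congr (_ * nth _ _ _).
by rewrite addnA (addnBAC m id).
Qed.

Lemma other_atoms_polyE s m :
  other_atoms_poly x s m = 'X^m - rVpoly (lambda_vec x s m)^T.
Proof.
by rewrite rVpoly_sum; congr (_ - _); apply: eq_bigr => i _; rewrite [in RHS]mxE.
Qed.

Lemma size_other_atoms_poly s m : size (other_atoms_poly x s m) = m.+1.
Proof.
rewrite other_atoms_polyE size_polyDl size_polyXn// size_polyN ltnS.
exact: size_poly.
Qed.

Lemma other_atoms_poly_monic s m : other_atoms_poly x s m \is monic.
Proof.
rewrite monicE lead_coefE size_other_atoms_poly other_atoms_polyE /= coefB.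
by rewrite coefXn eqxx nth_default ?subr0// size_poly.
Qed.

(** Row [k] of the system says that X^m minus the polynomial of [c] is orthogonal to X^k for the
    form L(f q r). *)
Lemma lambda_vecP s m (c : 'cV[R]_m) : localizing_mx s f m \in unitmx ->
  c = lambda_vec x s m <-> forall k, (k < m)%N ->
    Riesz_fun (nth 0 s) (f * ('X^m - rVpoly c^T) * 'X^k) = 0.
Proof.
set H := localizing_mx s f m => Hu; rewrite /lambda_vec -/H.
set b := (X in invmx _ *m X).
have row_k (k : 'I_m) :
    Riesz_fun (nth 0 s) (f * ('X^m - rVpoly c^T) * 'X^k) = b k 0 - (H *m c) k 0.
  rewrite /b localizing_rhsE.
  have -> : (H *m c) k 0 = (c^T *m H) 0 k.
    by rewrite -[in RHS](tr_localizing_mx s m : H^T = H) -trmx_mul [RHS]mxE.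
  by rewrite mul_localizing_mx -linearB /= mulrBr mulrBl -mulrA -exprD.
split=> [cE k km|Hc].
  by rewrite [LHS](row_k (Ordinal km)) cE mulKVmx// subrr.
apply: (canRL (mulKmx Hu)); apply/matrixP => k j; rewrite ord1.
by apply/eqP; rewrite eq_sym -subr_eq0 -row_k Hc.
Qed.

Lemma other_atoms_poly_annihilated s m k : localizing_mx s f m \in unitmx ->
  (k < m)%N -> Riesz_fun (nth 0 s) (f * other_atoms_poly x s m * 'X^k) = 0.
Proof. by move=> Hu; rewrite other_atoms_polyE; apply: (lambda_vecP _ Hu).1. Qed.

(** The coefficients of X^m - q solve the linear system, whose solution is unique. *)
Lemma other_atoms_poly_unique s m q : localizing_mx s f m \in unitmx ->
  q \is monic -> size q = m.+1 ->
  (forall k, (k < m)%N -> Riesz_fun (nth 0 s) (f * q * 'X^k) = 0) ->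
  q = other_atoms_poly x s m.
Proof.
rewrite other_atoms_polyE => Hu /monicP qm sq qs.
pose r : {poly R} := 'X^m - q.
have sr : (size r <= m)%N.
  apply/leq_sizeP => j; rewrite leq_eqVlt coefB coefXn => /predU1P[<-|mj].
    by move: qm; rewrite lead_coefE sq /= => ->; rewrite eqxx subrr.
  by rewrite gtn_eqF// nth_default ?sq// subrr.
have qE : q = 'X^m - rVpoly (poly_rV r : 'rV_m)^T^T.
  by rewrite trmxK poly_rV_K// opprB addrCA subrr addr0.
have <- : (poly_rV r)^T = lambda_vec x s m.
  by apply/(lambda_vecP _ Hu) => k km; rewrite -qE qs.
by rewrite -qE.
Qed.

End PrescribedAtoms.

(** * Positive definite extensions versus atomic moment sequences *)

Section AtomicMeasureAlgebra.
Variables (R : realType) (d m : nat) (x : 'I_d -> R) (s : seq R).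
Hypotheses (d0 : (0 < d)%N) (x_inj : injective x) (ss : (d + 2 * m <= size s)%N).
Local Notation f := (root_poly x).
Implicit Types (p q r : {poly R}).
Local Notation g := (other_atoms_poly x s m).
Local Notation E := (rec_extension (d + m) (f * g) (take (d + 2 * m) s)).

Let size_take_s : size (take (d + 2 * m) s) = (d + 2 * m)%N.
Proof. by rewrite size_takel. Qed.

Let fg_monic : f * g \is monic.
Proof. by rewrite monicMr ?root_poly_monic// other_atoms_poly_monic. Qed.

Let size_fg : size (f * g) = (d + m).+1.
Proof.
rewrite size_Mmonic ?monic_neq0 ?root_poly_monic ?other_atoms_poly_monic//.
by rewrite size_root_poly size_other_atoms_poly addSn addnS.
Qed.

Let E_take u : (u < d + 2 * m)%N -> E u = s`_u.
Proof. by move=> us; rewrite rec_extension_base ?size_take_s// nth_take. Qed.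

(** [f * g * 'X^k] fits in the first [d + 2 * m] moments exactly when [k < m], the range of the
    orthogonality relations. *)
Lemma rec_extension_other_atoms_annihilated q :
  localizing_mx s f m \in unitmx -> Riesz_fun E (f * g * q) = 0.
Proof.
move=> Hu; move: q; apply: rec_extension_annihilated => //.
  by rewrite size_take_s addn_gt0 d0 leq_add2l leq_pmull.
move=> k; rewrite size_take_s mul2n -addnn addnA ltn_add2l => km.
rewrite -[RHS](other_atoms_poly_annihilated Hu km).
apply: (@eq_Riesz_fun _ _ _ (d + m + k).+1).
  by rewrite size_Mmonic ?monicXn ?monic_neq0// size_fg size_polyXn /= addnS.
move=> i ik; rewrite nth_take//; apply: leq_trans ik _.
by rewrite ltn_add2l.
Qed.

Lemma quadrature_of_posdef : localizing_mx s f m \in unitmx ->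
  posdefmx (moment_mx E (d + m - 1)) ->
  exists t rho, [/\ uniq t, size t = (d + m)%N, forall y, y \in t -> 0 < rho y,
    E =1 atomic_moments t rho &
    forall y, (y \in t) = (y \in codom x) || root g y] /\
    (forall y, root g y -> y \notin codom x).
Proof.
move=> Hu /posdef_moment_mxP; rewrite subn1 prednK ?addn_gt0 ?d0// => pos.
have Ep q := rec_extension_other_atoms_annihilated q Hu.
have [t [rho [ut fgE rho0 Erho]]] := Gauss_quadrature fg_monic size_fg Ep pos.
exists t, rho; split; first split=> //.
- by move: size_fg; rewrite fgE size_prod_XsubC => -[].
- by move=> y; rewrite -root_prod_XsubC -fgE rootM root_root_poly.
(* The roots of [f * g] are simple, so [f] and [g] are coprime and share no root. *)
move=> y gy; rewrite -root_root_poly; apply/negP => fy.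
have : separable_poly (f * g) by rewrite fgE separable_prod_XsubC ut.
rewrite separable_mul => /and3P[_ _ cfg].
by have := coprimep_root cfg fy; rewrite -rootE gy.
Qed.

(** * From given atoms and weights to the conditions on matrices *)

Section FromMeasure.
Variables (t : seq R) (rho : R -> R).
Hypotheses (ut : uniq t) (st : size t = (d + m)%N) (xt : forall i, x i \in t).
Hypothesis rho0 : forall y, y \in t -> 0 < rho y.
Hypothesis s_rho : forall i, (i < d + 2 * m)%N -> s`_i = atomic_moments t rho i.

Let others := [seq y <- t | y \notin codom x].

Let perm_others : perm_eq t (codom x ++ others).
Proof.
apply: uniq_perm => //.
  rewrite cat_uniq filter_uniq// andbT; apply/andP; split.
    by rewrite codomE map_inj_uniq ?enum_uniq.
  by apply/hasPn => y; rewrite mem_filter => /andP[].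
move=> y; rewrite mem_cat mem_filter; have [/codomP[i ->]|] := boolP (y \in codom x).
  by rewrite xt.
by [].
Qed.

Let size_others : size others = m.
Proof.
apply/eqP; rewrite -(eqn_add2l d) -st (perm_size perm_others).
by rewrite size_cat size_codom card_ord.
Qed.

Let q0 : {poly R} := \prod_(y <- others) ('X - y%:P).

Let fq0E : f * q0 = \prod_(y <- t) ('X - y%:P).
Proof. by rewrite root_polyE -big_cat; apply/esym/perm_big. Qed.

Let Riesz_fun_s p : (size p <= d + 2 * m)%N ->
  Riesz_fun (nth 0 s) p = \sum_(y <- t) rho y * p.[y].
Proof. by move=> /eq_Riesz_fun/(_ s_rho)->; exact: Riesz_fun_atomic. Qed.

(** A kernel vector is a polynomial of degree below [m]; the quadrature forces it to vanish at the
    [m] other atoms, so it is 0. *)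
Lemma localizing_mx_unit_of_atomic : localizing_mx s f m \in unitmx.
Proof.
rewrite unitmxE unitfE; apply/det0P => -[v v0 vH].
suff /eqP : rVpoly v = 0.
  by apply/negP; apply: contra v0 => /eqP v0; rewrite -[v]rVpolyK v0 linear0.
have sv : (size (rVpoly v) <= m)%N by exact: size_poly.
have vr r : (size r <= m)%N -> Riesz_fun (nth 0 s) (f * rVpoly v * r) = 0.
  move=> rm; rewrite -[r]coefK poly_def mulr_sumr linear_sum big1// => i _.
  have im : (i < m)%N by rewrite (leq_trans (ltn_ord i)).
  rewrite -scalerAr linearZ /= -[i : nat]/(val (Ordinal im)).
  by rewrite -mul_localizing_mx vH mxE mulr0.
apply: (@roots_geq_poly_eq0 _ _ others); rewrite ?filter_uniq ?size_others//.
apply/allP => y yo; have := yo; rewrite mem_filter => /andP[yx yt].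
(* Testing against [r] isolates the atom [y]: [f] vanishes at the prescribed atoms and [r] at the
   remaining ones. *)
pose r : {poly R} := \prod_(z <- rem y others) ('X - z%:P).
have m0 : (0 < m)%N by rewrite -size_others lt0n size_eq0; apply: contraTneq yo => ->.
have sr : size r = m by rewrite size_prod_XsubC size_rem// size_others prednK.
have := vr r; rewrite sr leqnn => /(_ isT); rewrite Riesz_fun_s; last first.
  rewrite (leq_trans (size_polyMleq _ _))// sr -subn1 leq_subLR mul2n -addnn !addnA.
  rewrite leq_add2r (leq_trans (size_polyMleq _ _))// size_root_poly /= add1n.
  by rewrite (leq_trans (leq_add (leqnn d) sv)).
rewrite (bigD1_seq y)//= big1_seq ?addr0.
  move=> /eqP; rewrite !hornerM !mulf_eq0 gt_eqF ?rho0//= -!rootE root_root_poly.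
  rewrite (negPf yx) /= root_prod_XsubC mem_rem_uniqF ?filter_uniq// orbF.
  by [].
move=> z /andP[zy zt]; rewrite !hornerM.
have [zx|zx] := boolP (z \in codom x).
  by move: zx; rewrite -root_root_poly => /rootP->; rewrite !mul0r mulr0.
have /rootP -> : root r z.
  by rewrite root_prod_XsubC mem_rem_uniq ?filter_uniq// !inE zy mem_filter zx.
by rewrite !mulr0.
Qed.

(** [f * q0] vanishes at all atoms, so [q0] satisfies the orthogonality relations that characterize
    [g]. *)
Lemma other_atoms_poly_of_atomic : f * g = \prod_(y <- t) ('X - y%:P).
Proof.
rewrite -fq0E; congr (_ * _); apply/esym/other_atoms_poly_unique => //.
- exact: localizing_mx_unit_of_atomic.
- exact: monic_prod_XsubC.
- by rewrite size_prod_XsubC size_others.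
move=> k km; rewrite Riesz_fun_s fq0E.
  apply: big1_seq => y /andP[_ yt]; rewrite hornerM.
  by rewrite (rootP _ : (\prod_(z <- t) ('X - z%:P)).[y] = 0) ?root_prod_XsubC//
    mul0r mulr0.
rewrite size_Mmonic ?monicXn ?monic_neq0 ?monic_prod_XsubC//.
by rewrite size_prod_XsubC st size_polyXn addnS /= mul2n -addnn addnA ltn_add2l.
Qed.

(** Both sequences are annihilated by the multiples of [f * g] and share their first [d + m]
    terms. *)
Lemma rec_extension_of_atomic : E =1 atomic_moments t rho.
Proof.
apply: (@Riesz_fun_annihilated_eq _ _ _ (f * g) (d + m)) => //.
- move=> q; apply: rec_extension_other_atoms_annihilated.
  exact: localizing_mx_unit_of_atomic.
- move=> q; rewrite Riesz_fun_atomic other_atoms_poly_of_atomic.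
  apply: big1_seq => y /andP[_ yt]; rewrite hornerM.
  by rewrite (rootP _ : (\prod_(z <- t) ('X - z%:P)).[y] = 0) ?root_prod_XsubC//
    mul0r mulr0.
move=> i id; have im : (i < d + 2 * m)%N.
  by rewrite (leq_trans id)// leq_add2l leq_pmull.
by rewrite E_take// s_rho.
Qed.

(** A nonzero polynomial of degree below [d + m] misses one of the [d + m] atoms, which contributes
    a positive term. *)
Lemma posdef_of_atomic : posdefmx (moment_mx E (d + m - 1)).
Proof.
apply/posdef_moment_mxP => p p0; rewrite subn1 prednK ?addn_gt0 ?d0// => sp.
rewrite (eq_Riesz_fun (leqnn _) (fun i _ => rec_extension_of_atomic i)) Riesz_fun_atomic.
have /allPn[y yt py] : ~~ all (root p) t.
  by apply: contraNN p0 => pt; apply/eqP/(roots_geq_poly_eq0 pt); rewrite ?st.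
rewrite (bigD1_seq y)//= ltr_wpDr//.
  rewrite big_seq_cond sumr_ge0// => z /andP[zt _].
  by rewrite hornerM -expr2 mulr_ge0 ?sqr_ge0// ltW// rho0.
by rewrite hornerM -expr2 mulr_gt0 ?rho0// exprn_even_gt0.
Qed.

End FromMeasure.

End AtomicMeasureAlgebra.

(** * Finite sums of Dirac measures and their moments *)

Section AtomicMeasure.
Variable R : realType.
Implicit Types (t : seq R) (rho : R -> R).
Local Notation measR := {measure set (measurableTypeR R) -> \bar R}.

(* The absolute value is a dummy: it makes the weights nonnegative for all rho,
   as mscale requires, and disappears for rho > 0. *)
Definition dirac_sum t rho : measR :=
  msum (fun k => mscale (NngNum (normr_ge0 (rho t`_k)))
    (\d_(t`_k : measurableTypeR R) : {measure set (measurableTypeR R) -> \bar R}))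
    (size t).

Lemma dirac_sumE t rho A : (forall y, y \in t -> 0 < rho y) ->
  dirac_sum t rho A =
  (\sum_(y <- t) (rho y)%:E * \d_(y : measurableTypeR R) A)%E.
Proof.
move=> rho0; rewrite (big_nth 0) big_mkord; apply: eq_bigr => k _.
by rewrite -[rho _ in RHS]gtr0_norm ?rho0 ?mem_nth.
Qed.

(** Additivity and scaling in the measure settle nonnegative integrands; powers may change sign, so
    positive and negative parts are then subtracted. *)
Lemma integral_dirac_sum t rho (f : measurableTypeR R -> R) :
  measurable_fun [set: measurableTypeR R] f -> (forall y, y \in t -> 0 < rho y) ->
  (\int[dirac_sum t rho]_y (f y)%:E)%E = (\sum_(y <- t) rho y * f y)%:E.
Proof.
move=> mf rho0.
have ge0 (h : measurableTypeR R -> R) :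
    measurable_fun [set: measurableTypeR R] h -> (forall y, 0 <= h y) ->
    (\int[dirac_sum t rho]_y (h y)%:E)%E = (\sum_(y <- t) rho y * h y)%:E.
  move=> mh h0; have mh' : measurable_fun [set: measurableTypeR R] (EFin \o h).
    exact/measurable_EFinP.
  rewrite ge0_integral_measure_sum//; last by move=> y _; rewrite lee_fin.
  rewrite (big_nth 0) big_mkord -sumEFin; apply: eq_bigr => k _.
  rewrite ge0_integral_mscale//; last by move=> y _; rewrite lee_fin.
  by rewrite integral_dirac// diracT mul1e /= gtr0_norm// rho0// mem_nth.
rewrite integralE -[X in X^\+%E]/(EFin \o f) -[X in X^\-%E]/(EFin \o f) funerpos funerneg.
rewrite (ge0 _ (measurable_funrpos mf) (funrpos_ge0 f)).
rewrite (ge0 _ (measurable_funrneg mf) (funrneg_ge0 f)).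
rewrite -EFinB -sumrB; congr (_%:E); apply: eq_bigr => y _.
by rewrite -mulrBr -[in RHS](funrposBneg f).
Qed.

Lemma moment_atomic (mu : measR) t : atomic_measure mu t ->
  exists2 rho, (forall y, y \in t -> 0 < rho y) &
    forall i, moment mu i = (atomic_moments t rho i)%:E.
Proof.
move=> [ut [rho [rho0 muE]]]; exists rho => // i; rewrite /moment.
rewrite (eq_measure_integral (dirac_sum t rho)) => [|A mA _]; last first.
  by rewrite dirac_sumE// muE.
by rewrite integral_dirac_sum//; exact: exprn_measurable.
Qed.

Lemma dirac_sum_atomic t rho : uniq t -> (forall y, y \in t -> 0 < rho y) ->
  atomic_measure (dirac_sum t rho) t.
Proof. by move=> ut rho0; split=> //; exists rho; split=> // A _; exact: dirac_sumE. Qed.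

Lemma moment_dirac_sum t rho i : (forall y, y \in t -> 0 < rho y) ->
  moment (dirac_sum t rho) i = (atomic_moments t rho i)%:E.
Proof. by move=> rho0; rewrite /moment integral_dirac_sum//; exact: exprn_measurable. Qed.

End AtomicMeasure.

(** * The common criterion for (a) and (b), in terms of measures *)

Section Representation.
Variables (R : realType) (d m : nat) (x : 'I_d -> R) (s : seq R).
Hypotheses (d0 : (0 < d)%N) (x_inj : injective x) (ss : (d + 2 * m <= size s)%N).
Local Notation f := (root_poly x).
Local Notation g := (other_atoms_poly x s m).
Local Notation E := (rec_extension (d + m) (f * g) (take (d + 2 * m) s)).

(** The moments are identified for every [u] because (b) compares those of index [D - 1] and [D],
    beyond the truncated sequence. *)
Lemma atomic_representation_necessary mu t :
  R_representing_atomic (take (d + 2 * m) s) (d + m) mu t ->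
  (forall i, x i \in t) ->
  [/\ localizing_mx s f m \in unitmx, posdefmx (moment_mx E (d + m - 1)) &
    forall u, moment mu u = (E u)%:E].
Proof.
move=> [mut st srep] xt; have ut := mut.1.
have [rho rho0 mu_rho] := moment_atomic mut.
have s_rho i : (i < d + 2 * m)%N -> s`_i = atomic_moments t rho i.
  move=> im; have := srep i; rewrite size_takel// => /(_ im).
  by rewrite nth_take// mu_rho => -[].
split; first exact: (localizing_mx_unit_of_atomic x_inj ut st xt rho0 s_rho).
- exact: (posdef_of_atomic d0 x_inj ss ut st xt rho0 s_rho).
- by move=> u; rewrite (rec_extension_of_atomic d0 x_inj ss ut st xt rho0 s_rho) mu_rho.
Qed.

Lemma atomic_representation_sufficient : localizing_mx s f m \in unitmx ->
  posdefmx (moment_mx E (d + m - 1)) ->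
  exists mu t, [/\ R_representing_atomic (take (d + 2 * m) s) (d + m) mu t,
    forall i, x i \in t, forall u, moment mu u = (E u)%:E &
    forall y, (y \in t) && (y \notin codom x) = root g y].
Proof.
move=> Hu Epos.
have [t [rho [[ut st rho0 Erho tE] gx]]] := quadrature_of_posdef d0 ss Hu Epos.
have muE u : moment (dirac_sum t rho) u = (E u)%:E.
  by rewrite moment_dirac_sum// Erho.
exists (dirac_sum t rho), t; split=> //.
- split=> //; first exact: dirac_sum_atomic.
  by move=> i im; rewrite muE rec_extension_base.
- by move=> i; rewrite tE codom_f.
move=> y; rewrite tE; have [yx|yx] := boolP (y \in codom x); last by rewrite andbT.
by rewrite andbF; apply/esym/negP => /gx; rewrite yx.
Qed.

End Representation.

(** * The equivalence, by cases on whether infinity is an atom *)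

Theorem theorem3p2 (R : realType) (d1 d2 : nat) (hd1 : (0 < d1)%N)
    (hd2 : (0 < d2)%N) (x : 'I_d1 -> R) (hx : injective x)
    (D : nat) (hD : D = (d1 + 2 * d2 - 1)%N) (gamma : D.+1.-tuple R)
    (hM : posdefmx (moment_mx (nth 0 gamma) D./2)) :
  let f := root_poly x in
  let g := other_atoms_poly x gamma d2 in
  let gammaA := rec_extension (d1 + d2) (f * g) gamma in
  let condA :=
    localizing_mx gamma f d2 \in unitmx /\
    posdefmx (moment_mx gammaA (d1 + d2 - 1)) in
  let representsA mu s :=
    R_representing_atomic gamma (d1 + d2) mu s /\ (forall i, x i \in s) in
  let h := f * other_atoms_poly x gamma (d2 - 1) in
  let gammahat := take (D - 1) gamma in
  let gammaB := rec_extension (d1 + d2 - 1) h gammahat in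
  let condB :=
    localizing_mx gamma f (d2 - 1) \in unitmx /\
    [/\ posdefmx (moment_mx gammaB (d1 + d2 - 2)),
        gammaB (D - 1)%N = gamma`_(D - 1) & gammaB D < gamma`_D] in
  let representsB mu s :=
    [/\ R_representing_atomic gammahat (d1 + d2 - 1) mu s,
        (forall i, x i \in s),
        moment mu (D - 1) = (gamma`_(D - 1))%:E &
        exists2 alpha : R, 0 < alpha & moment mu D = (gamma`_D - alpha)%:E] in
  let statement1 :=
    exists2 s : seq R, Rinf_representing_atomic gamma (d1 + d2) s &
      forall i, x i \in s in
  let statement2a :=
    exists mu (s : seq R), [/\ representsA mu s, condA &
      forall t : R, (t \in s) && (t \notin codom x) = root g t] in
  let statement2b :=
    exists mu (s : seq R), representsB mu s /\ condB in
  [/\ statement1 <-> statement2a \/ statement2b,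
      (exists mu s, representsA mu s) <-> condA &
      (exists mu s, representsB mu s) <-> condB].
Proof.
move=> f g gammaA condA representsA h gammahat gammaB condB representsB
  statement1 statement2a statement2b.
have sizeg : size gamma = (d1 + 2 * d2)%N by rewrite size_tuple; lia.
have takeA : take (d1 + 2 * d2) gamma = gamma by rewrite take_oversize// sizeg.
have sizeA : (d1 + 2 * d2 <= size gamma)%N by rewrite sizeg.
(* Taking [m = d2 - 1] keeps the first [D - 1] moments, which are the terms of [gammahat]. *)
have D1 : (D - 1 = d1 + 2 * (d2 - 1))%N by lia.
have sizeh : (d1 + 2 * (d2 - 1) <= size gamma)%N by rewrite sizeg; lia.
have sizeghat : size gammahat = (D - 1)%N.
  by rewrite size_takel// size_tuple; lia.
have N1 : (d1 + d2 - 1 = d1 + (d2 - 1))%N by lia.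
have N2 : (d1 + d2 - 2 = d1 + (d2 - 1) - 1)%N by lia.
have necA mu t : representsA mu t -> condA.
  move=> [mut xt].
  have := @atomic_representation_necessary _ _ d2 _ gamma hd1 hx sizeA mu t.
  by rewrite takeA => /(_ mut xt)[].
have sufA : condA -> statement2a.
  move=> cA; have [Hu pos] := cA.
  have := atomic_representation_sufficient hd1 sizeA Hu; rewrite takeA.
  by move=> /(_ pos)[mu [t [mut xt _ tg]]]; exists mu, t.
have necB mu t : representsB mu t -> condB.
  move=> [+ xt muD1 [a a0 muD]]; rewrite /gammahat D1 N1.
  move=> /(atomic_representation_necessary hd1 hx sizeh)/(_ xt)[Hu pos muE].
  split=> //; rewrite /gammaB /gammahat D1 N1 N2; split=> //.
    by move: muD1; rewrite D1 muE => -[].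
  by move: muD; rewrite muE => -[->]; rewrite ltrBlDr ltrDl.
have sufB : condB -> statement2b.
  move=> cB; have [Hu] := cB; rewrite /gammaB /gammahat N1 N2 D1.
  move=> -[/(atomic_representation_sufficient hd1 sizeh Hu)].
  move=> [mu [t [mut xt muE _]]] EB1 EBD; exists mu, t; split=> //.
  split; rewrite ?/gammahat ?N1 ?D1//; first by rewrite muE EB1.
  (* The required [alpha] is the gap between [gamma] and its recursive prediction at index [D]. *)
  exists (gamma`_D - gammaB D); first by rewrite subr_gt0; have [_ []] := cB.
  by rewrite muE subKr /gammaB /gammahat N1 D1.
split; last 2 first.
- split=> [[mu [t /necA]]//|/sufA[mu [t [mut _ _]]]].
  by exists mu, t.
- split=> [[mu [t /necB]]//|/sufB[mu [t [mut _]]]].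
  by exists mu, t.
split=> [[t [[mu mut]|[mu [a [mut st a0 muE]]]] xt]|].
- by left; apply: sufA; apply: (necA mu t).
- right; apply: sufB; apply: (necB mu t).
  have muE' i : (i <= D)%N -> (gamma`_i)%:E = (moment mu i + (a * (i == D)%:R)%:E)%E.
    by move=> iD; rewrite muE ?size_tuple ?ltnS// /ev_infty coefXn [_ == i]eq_sym.
  (* Infinity contributes only at index [D], so the real part of the measure has all lower moments
     right. *)
  have muE0 i : (i < D)%N -> moment mu i = (gamma`_i)%:E.
    by move=> iD; rewrite (muE' i (ltnW iD)) ltn_eqF// mulr0 adde0.
  split=> //.
  + split=> //; first by rewrite -st subn1.
    move=> i; rewrite sizeghat => iD; rewrite nth_take// muE0//; lia.
  + by apply: muE0; lia.
  (* The weight at infinity serves as [alpha]; finiteness of the moment allows subtraction in the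
     extended reals. *)
  + exists a => //; have [rho _ mur] := moment_atomic mut.
    move: (muE' D (leqnn _)); rewrite eqxx mulr1 mur -EFinD => -[->].
    by rewrite addrK.
- move=> [[mu [t [[mut xt] _ _]]]|[mu [t [[[mut st srep] xt muD1 [a a0 muD]] _]]]].
    by exists t => //; left; exists mu.
  (* Conversely, the defect [a] at index [D] becomes the weight at infinity. *)
  exists t => //; right; exists mu, a; split=> //; first by rewrite st; lia.
  move=> i; rewrite size_tuple ltnS /ev_infty coefXn [_ == i]eq_sym => iD.
  have [->|] := eqVneq i D; first by rewrite muD mulr1 -EFinD subrK.
  move=> iD'; rewrite mulr0 adde0; have [->|iD1] := eqVneq i (D - 1)%N.
    by rewrite muD1.
  have ih : (i < D - 1)%N by lia.
  by rewrite -srep ?sizeghat// nth_take.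
Qed.
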